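(* Let $(\Omega,\mathcal L,\mu)$ be a measure space, $X$ a Banach space, and let $\widetilde{\Gamma}\colon\Omega\to\mathcal F(X)$ be a Pettis integrable fuzzy mapping on $\Omega$. Then its fuzzy Pettis integral $\widetilde{M_\Gamma}\colon\mathcal L\to\mathcal F(X)$ is a generalized fuzzy number measure.
   Context: $(\Omega,\mathcal L,\mu)$ is a measure space, $\mathcal L$ being the family of all $\mu$-measurable sets; $X$ is a (real) Banach space with dual $X^*$. $cwk(X)$ is the family of nonempty convex weakly compact subsets of $X$. For $A\in cwk(X)$ and $x^*\in X^*$, $s(x^*,A)=\sup\{\langle x^*,y\rangle: y\in A\}$. Fuzzy numbers: for $u\colon X\to[0,1]$ and $r\in(0,1]$ put $[u]^r=\{x\in X: u(x)\ge r\}$. $u$ is a generalized fuzzy number if $[u]^r\in cwk(X)$ for every $r\in(0,1]$; $\mathcal F(X)$ is the set of all generalized fuzzy numbers. The null element $\theta\in\mathcal F(X)$ is $\theta(0)=1$, $\theta(x)=0$ for $x\ne0$. A fuzzy mapping is a map $\widetilde{\Gamma}\colon\Omega\to\mathcal F(X)$; set $\widetilde{\Gamma}_r(\omega):=[\widetilde{\Gamma}(\omega)]^r$. A multifunction $\Gamma\colon\Omega\to cwk(X)$ is scalarly integrable if $\omega\mapsto s(x^*,\Gamma(\omega))$ is $\mu$-integrable for each $x^*\in X^*$; it is Pettis integrable if moreover for each $A\in\mathcal L$ there is $W_\Gamma(A)\in cwk(X)$ with $s(x^*,W_\Gamma(A))=\int_A s(x^*,\Gamma)\,d\mu$ for all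 $x^*\in X^*$. A fuzzy mapping $\widetilde{\Gamma}$ is Pettis integrable on $\Omega$ if every $\widetilde{\Gamma}_r$, $r\in(0,1]$, is a Pettis integrable multifunction and, for each $A\in\mathcal L$, there is $\widetilde{M_\Gamma}(A)\in\mathcal F(X)$ such that $s(x^*,[\widetilde{M_\Gamma}(A)]^r)=\int_A s(x^*,\widetilde{\Gamma}_r)\,d\mu$ for all $r\in(0,1]$ and $x^*\in X^*$. The map $\widetilde{M_\Gamma}\colon\mathcal L\to\mathcal F(X)$ is called the fuzzy Pettis integral of $\widetilde{\Gamma}$. A mapping $\widetilde M\colon\mathcal L\to\mathcal F(X)$ is a generalized fuzzy number measure if (1) $\widetilde M(\emptyset)=\theta$; (2) for any sequence $(A_n)_{n\ge1}$ of pairwise disjoint elements of $\mathcal L$, $\widetilde M(\bigcup_{n=1}^\infty A_n)=\sum_{n=1}^\infty\widetilde M(A_n)$, where, for $x\in X$, $$\Big(\sum_{n=1}^\infty\widetilde M(A_n)\Big)(x)=\sup\Big\{\inf_n\widetilde M(A_n)(x_n): x=\sum_{n=1}^\infty x_n\ \text{(unconditionally convergent)}\Big\}.$$ *)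

(* Defs.v *)
From HB Require Import structures.
From mathcomp Require Import all_boot all_order all_algebra.
From mathcomp Require Import all_classical all_reals all_analysis.

Set Implicit Arguments.
Unset Strict Implicit.
Unset Printing Implicit Defensive.

Import Order.TTheory GRing.Theory Num.Theory.
Import numFieldNormedType.Exports.

Local Open Scope classical_set_scope.
Local Open Scope ring_scope.

Record dual (R : realType) (X : normedModType R) := Dual {
  dual_fun :> {linear X -> R^o} ;
  dual_continuous : continuous dual_fun }.

(* The carrier X with the coarsest topology making every element of the dual
   continuous. *)
Definition weak_space (R : realType) (X : normedModType R) : topologicalType :=
  sup_topology (fun f : dual X =>
    Topological.on (initial_topology (f : X -> R^o))).

Definition weakly_compact (R : realType) (X : normedModType R) (A : set X) :=
  compact (A : set (weak_space X)).

Definition cwk (R : realType) (X : normedModType R) : set (set X) :=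
  [set A | [/\ A !=set0, convex_set (A : set (convex_lmodType X))
             & weakly_compact A]].

Definition support_fun (R : realType) (X : normedModType R)
    (f : dual X) (A : set X) : \bar R :=
  ereal_sup [set (f y)%:E | y in A].

Definition level (R : realType) (X : normedModType R) (u : X -> R) (r : R)
    : set X :=
  [set x | r <= u x].

Record fuzzyNumber (R : realType) (X : normedModType R) := FuzzyNumber {
  fuzzy_fun :> X -> R ;
  fuzzy_fun01 : forall x, 0 <= fuzzy_fun x <= 1 ;
  fuzzy_fun_cwk : forall r, 0 < r <= 1 -> cwk (level fuzzy_fun r) }.

Section fuzzy_null.
Context (R : realType) (X : normedModType R).

Definition fuzzy_null_fun (x : X) : R := (x == 0)%:R.

Lemma fuzzy_null_fun01 x : 0 <= fuzzy_null_fun x <= 1.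
Proof. by rewrite /fuzzy_null_fun; case: eqP => _; rewrite ?lexx ?ler01. Qed.

Lemma fuzzy_null_fun_cwk r : 0 < r <= 1 -> cwk (level fuzzy_null_fun r).
Proof.
move=> /andP[r0 r1].
have -> : level fuzzy_null_fun r = [set 0].
  apply/seteqP; split => x /=; rewrite /level /fuzzy_null_fun /=.
    by case: eqP => //= _; rewrite leNgt r0.
  by move=> ->; rewrite eqxx.
split.
- by exists 0.
- move=> x y l; rewrite !inE => -> ->.
  by rewrite convmm.
- exact: (@compact_set1 (weak_space X)).
Qed.

Definition fuzzy_null : fuzzyNumber X :=
  FuzzyNumber fuzzy_null_fun01 fuzzy_null_fun_cwk.

End fuzzy_null.

Definition unconditional_sum (R : realType) (X : normedModType R)
    (x_ : nat -> X) (x : X) :=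
  forall s : nat -> nat, bijective s -> series (x_ \o s) @ \oo --> x.

(* The infimum is over a nonempty subset of [0, 1], and so is the supremum:
   x is the unconditional sum of x, 0, 0, ... *)
Definition fuzzy_sum (R : realType) (X : normedModType R)
    (u : nat -> fuzzyNumber X) (x : X) : R :=
  sup [set inf (range (fun n => u n (x_ n)))
      | x_ in [set x_ : nat -> X | unconditional_sum x_ x]].

Section pettis.
Context d (T : measurableType d) (R : realType).
Variables (mu : {measure set T -> \bar R}) (X : normedModType R).

Definition scalarly_integrable (G : T -> set X) :=
  (forall w, cwk (G w)) /\
  forall f : dual X, mu.-integrable setT (fun w => support_fun f (G w)).

Definition pettis_integrable (G : T -> set X) :=
  scalarly_integrable G /\
  forall A, measurable A -> exists2 W : set X, cwk W &
    forall f : dual X,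
      support_fun f W = (\int[mu]_(w in A) support_fun f (G w))%E.

Definition fuzzy_pettis_integral_on (G : T -> fuzzyNumber X) (A : set T)
    (u : fuzzyNumber X) :=
  forall (r : R) (f : dual X), 0 < r <= 1 ->
    support_fun f (level u r) =
    (\int[mu]_(w in A) support_fun f (level (G w) r))%E.

Definition fuzzy_pettis_integrable (G : T -> fuzzyNumber X) :=
  (forall r, 0 < r <= 1 -> pettis_integrable (fun w => level (G w) r)) /\
  forall A, measurable A -> exists u, fuzzy_pettis_integral_on G A u.

(* Only the values of M on measurable sets matter. *)
Definition is_fuzzy_pettis_integral (G : T -> fuzzyNumber X)
    (M : set T -> fuzzyNumber X) :=
  forall A, measurable A -> fuzzy_pettis_integral_on G A (M A).

Definition fuzzy_number_measure (M : set T -> fuzzyNumber X) :=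
  M set0 = fuzzy_null X /\
  forall A : nat -> set T, (forall n, measurable (A n)) ->
    trivIset setT A ->
    M (\bigcup_n A n) = fuzzy_sum (fun n => M (A n)) :> (X -> R).

End pettis.

(* Main.v *)
(* For fixed r, the set function E |-> [M E]^r has the countably additive support
   functions E |-> \int_E s(f, G_r).  If x is the unconditional sum of points
   x_n of [M (A n)]^r, then f x <= s(f, [M (\bigcup_n A n)]^r) for every f, and
   Hahn-Banach puts x in [M (\bigcup_n A n)]^r.  Conversely, finite additivity of
   the support functions and weak compactness give
     [M (E `|` F)]^r = [M E]^r + [M F]^r   for disjoint E and F,
   so a point x of [M (\bigcup_n A n)]^r can be peeled off successively as
   x_0 + ... + x_(n-1) + v_n with x_k in [M (A k)]^r and v_n in the r-level of
   the n-th tail.  The v_n tend weakly to 0, and weak compactness makes every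
   such series weakly subseries convergent even after grouping its terms into
   blocks; the Orlicz-Pettis theorem then upgrades weak convergence to
   unconditional norm convergence. *)
From HB Require Import structures.
Require Import Defs.
From mathcomp Require Import all_boot all_order all_algebra.
From mathcomp Require Import all_classical all_reals all_analysis.
From mathcomp Require Import ring lra zify.

Set Implicit Arguments.
Unset Strict Implicit.
Unset Printing Implicit Defensive.

Import Order.TTheory GRing.Theory Num.Theory.
Import numFieldNormedType.Exports.
Local Open Scope classical_set_scope.
Local Open Scope ring_scope.

(** * The Hahn-Banach theorem *)

Section sublinear.
Context (R : realType) (V : lmodType R).
Implicit Types (p q : V -> R) (C : set V).

Definition sublinear p :=
  (forall x y, p (x + y) <= p x + p y) /\
  (forall t x, 0 <= t -> p (t *: x) <= t * p x).

Definition segment_closed C := forall x y s t,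
  C x -> C y -> 0 <= s -> 0 <= t -> s + t = 1 -> C (s *: x + t *: y).

Lemma sublinear0 p : sublinear p -> p 0 = 0.
Proof.
move=> [pD pZ]; apply/eqP; rewrite eq_le; apply/andP; split.
  by have := pZ 0 0 (lexx _); rewrite scale0r mul0r.
by have := pD 0 0; rewrite addr0; lra.
Qed.

Lemma sublinear_oppr_ge p x : sublinear p -> - p (- x) <= p x.
Proof.
move=> sp; have := sp.1 x (- x); rewrite subrr (sublinear0 sp); lra.
Qed.

(* p z is the infimum over t >= 0 and c in C of q (z + t c) - t delta. *)
Lemma sublinear_lower q C (delta : R) :
  sublinear q -> C !=set0 -> segment_closed C ->
  (forall c, C c -> delta <= q c) ->
  exists p, [/\ sublinear p, forall z, p z <= q z &
                 forall c, C c -> p (- c) <= - delta].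
Proof.
move=> sq [c0 Cc0] convC qC; have [qD qZ] := sq.
pose E z := [set q (z + a.1 *: a.2) - a.1 * delta
            | a in [set a : R * V | 0 <= a.1 /\ C a.2]].
have En0 z : E z !=set0 by exists (q (z + 0 *: c0) - 0 * delta), (0, c0).
have qCZ t c : 0 <= t -> C c -> t * delta <= q (t *: c).
  move=> t0 Cc; have [->|tn0] := eqVneq t 0.
    by rewrite mul0r scale0r (sublinear0 sq).
  have tgt0 : 0 < t by rewrite lt_neqAle eq_sym tn0.
  have := qZ t^-1 (t *: c); rewrite invr_ge0 t0 scalerA mulVf// scale1r.
  move=> /(_ isT) h; rewrite mulrC -ler_pdivlMr//.
  by rewrite mulrC (le_trans (qC _ Cc)).
have Elb z : lbound (E z) (- q (- z)).
  move=> _ [[t c] /= [t0 Cc] <-].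
  have := qD (z + t *: c) (- z); rewrite addrAC subrr add0r.
  by have := qCZ t c t0 Cc; lra.
have infE z t c : 0 <= t -> C c -> inf (E z) <= q (z + t *: c) - t * delta.
  move=> t0 Cc; apply: ge_inf; first by exists (- q (- z)); exact: Elb.
  by exists (t, c).
have leE z (r : R) :
    (forall t c, 0 <= t -> C c -> r <= q (z + t *: c) - t * delta) ->
    r <= inf (E z).
  by move=> h; apply: lb_le_inf => // _ [[t c] /= [t0 Cc] <-]; exact: h.
exists (fun z => inf (E z)); split; last first.
- move=> c Cc; have := infE (- c) 1 c ler01 Cc.
  by rewrite scale1r addNr (sublinear0 sq) mul1r sub0r.
- by move=> z; have := infE z 0 c0 (lexx _) Cc0; rewrite scale0r addr0 mul0r subr0.
split=> [x y|t x t0].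
- rewrite -lerBlDl; apply: (leE) => t c t0 Cc.
  rewrite lerBlDl -lerBlDr; apply: (leE) => s b s0 Cb.
  have [ts0|ts0] := eqVneq (s + t) 0.
    have [-> ->] : s = 0 /\ t = 0 by lra.
    have := infE (x + y) 0 c0 (lexx _) Cc0.
    by rewrite !scale0r !mul0r !addr0 !subr0; have := qD x y; lra.
  have st0 : 0 < s + t by rewrite lt_neqAle eq_sym ts0 addr_ge0.
  (* [e] is the weighted mean with (s + t) e = s b + t c, so the two pairs merge into one admissible
     pair. *)
  pose e := (s / (s + t)) *: b + (t / (s + t)) *: c.
  have Ce : C e.
    apply: convC => //; rewrite ?divr_ge0// ?(ltW st0)//.
    by rewrite -mulrDl mulfV.
  have := infE (x + y) (s + t) e (ltW st0) Ce.
  rewrite /e scalerDr !scalerA !(mulrC (s + t)) !divfK//.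
  have := qD (x + s *: b) (y + t *: c).
  rewrite addrACA; lra.
- have [->|tn0] := eqVneq t 0.
    rewrite scale0r mul0r; have := infE 0 0 c0 (lexx _) Cc0.
    by rewrite scale0r addr0 mul0r subr0 (sublinear0 sq).
  have tgt0 : 0 < t by rewrite lt_neqAle eq_sym tn0.
  rewrite mulrC -ler_pdivrMr//; apply: (leE) => s c s0 Cc.
  rewrite ler_pdivrMr//.
  have := infE (t *: x) (t * s) c (mulr_ge0 t0 s0) Cc.
  rewrite -scalerA -scalerDr.
  have := qZ t (x + s *: c) t0; lra.
Qed.

End sublinear.

Section hahn_banach.
Context (R : realType) (V : lmodType R).
Implicit Types p q : V -> R.

(** Zorn's lemma for the reversed pointwise order. A nonempty chain is bounded by its pointwise
    infimum, finite because each member [s] satisfies s z >= - p (- z). *)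
Lemma minimal_sublinear p : sublinear p -> exists q, [/\ sublinear q,
  forall z, q z <= p z &
  forall q', sublinear q' -> (forall z, q' z <= q z) -> forall z, q z <= q' z].
Proof.
move=> sp; pose T := {q : V -> R | sublinear q /\ forall z, q z <= p z}.
pose below (s t : T) := `[< forall z, sval t z <= sval s z >].
have [q qmin] : exists t, premaximal below t.
  apply: (ZL_preorder (exist _ p (conj sp (fun z => lexx _)) : T)).
  - by move=> s; apply/asboolP.
  - move=> r s t /asboolP rs /asboolP st; apply/asboolP => z.
    exact: le_trans (st z) (rs z).
  move=> A totA; have [[a Aa]|] := pselect (A !=set0); last first.
    move=> A0; exists (exist _ p (conj sp (fun z => lexx _)) : T) => s As.
    by exfalso; apply: A0; exists s.
  pose E z := [set sval s z | s in A].
  have Elb z : lbound (E z) (- p (- z)).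
    move=> _ [[s [ss sp']] _ <-] /=; apply: le_trans (sublinear_oppr_ge z ss).
    by rewrite lerN2.
  have infE z (s : T) : A s -> inf (E z) <= sval s z.
    by move=> As; apply: ge_inf; [exists (- p (- z)); exact: Elb|exists s].
  have leE z (r : R) : (forall s, A s -> r <= sval s z) -> r <= inf (E z).
    move=> h; apply: lb_le_inf; first by exists (sval a z), a.
    by move=> _ [s As <-]; exact: h.
  have sI : sublinear (fun z => inf (E z)).
    split=> [x y|t x t0].
      rewrite -lerBlDl; apply: (leE) => s As.
      rewrite lerBlDl -lerBlDr; apply: (leE) => t At; rewrite lerBlDr.
      (* In a chain the smaller of [s] and [t] serves at both [x] and [y]. *)
      have [/asboolP st|/asboolP ts] := totA s t As At.
        apply: (le_trans (infE _ _ At)).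
        by apply: (le_trans ((svalP t).1.1 _ _)); rewrite lerD2l.
      apply: (le_trans (infE _ _ As)).
      by apply: (le_trans ((svalP s).1.1 _ _)); rewrite lerD2r.
    have [->|tn0] := eqVneq t 0.
      rewrite scale0r mul0r; have := infE 0 _ Aa.
      by rewrite (sublinear0 (svalP a).1).
    have tgt0 : 0 < t by rewrite lt_neqAle eq_sym tn0.
    rewrite mulrC -ler_pdivrMr//; apply: (leE) => s As.
    rewrite ler_pdivrMr// mulrC.
    exact: le_trans (infE _ _ As) ((svalP s).1.2 _ _ t0).
  have Ip z : inf (E z) <= p z.
    exact: le_trans (infE _ _ Aa) ((svalP a).2 z).
  exists (exist _ _ (conj sI Ip) : T) => s As; apply/asboolP => z /=.
  exact: infE.
exists (sval q); split; [exact: (svalP q).1|exact: (svalP q).2|].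
move=> q' sq' q'q; have q'p z : q' z <= p z.
  exact: le_trans (q'q z) ((svalP q).2 z).
have /asboolP := qmin (exist _ q' (conj sq' q'p) : T) (asboolT q'q).
by [].
Qed.

(* A minimal sublinear functional q is linear: otherwise sublinear_lower,
   applied to C = {v} and delta = q v, would produce a smaller one. *)
Lemma sublinear_ge_linear p : sublinear p ->
  exists f : {linear V -> R^o}, forall z, f z <= p z.
Proof.
move=> /minimal_sublinear[q [sq qp qmin]]; have [qD qZ] := sq.
have q0 := sublinear0 sq.
have qN v : q (- v) = - q v.
  have [||//|q' [sq' q'q q'v]] := @sublinear_lower _ _ q [set v] (q v) sq.
  - by exists v.
  - by move=> x y s t -> -> _ _ st; rewrite /= -scalerDl st scale1r.
  - by move=> _ ->.
  have := le_trans (qmin _ sq' q'q (- v)) (q'v v erefl).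
  by have := sublinear_oppr_ge (- v) sq; rewrite opprK; lra.
have addq x y : q (x + y) = q x + q y.
  have := qD x y; have := qD (- x) (- y); rewrite -opprD !qN; lra.
have sclq t x : q (t *: x) = t * q x.
  have pos s : 0 <= s -> q (s *: x) = s * q x.
    move=> s0; have := qZ s x s0; have := qZ s (- x) s0.
    rewrite scalerN !qN; lra.
  have [/pos//|t0] := leP 0 t.
  by rewrite -[t]opprK scaleNr qN pos ?oppr_ge0 1?ltW//; ring.
have lq : linear (q : V -> R^o) by move=> t x y; rewrite addq sclq.
pose f := HB.pack_for {linear V -> R^o} (q : V -> R^o)
  (GRing.isLinear.Build _ _ _ _ _ lq).
by exists f.
Qed.

End hahn_banach.

(** * Duality *)

Lemma fmap_ultra (I J : Type) (g : I -> J) (U : set_system I) :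
  UltraFilter U -> UltraFilter (g @ U).
Proof.
move=> UU; split=> [|G PG UG]; first exact: fmap_proper_filter.
apply/seteqP; split=> // A GA; have [//|UnA] := in_ultra_setVsetC (g @^-1` A) UU.
have : G (A `&` ~` A) by apply: filterI => //; exact: UG.
by rewrite setICr => /filter_not_empty.
Qed.

Section duality.
Context (R : realType) (X : normedModType R).
Implicit Types (f g : dual X) (x y z : X) (C W : set X).

Lemma contraction_continuous (f : {linear X -> R^o}) :
  (forall z, `|f z| <= `|z|) -> continuous f.
Proof.
move=> fle; apply: bounded_linear_continuous; apply/linear_boundedP.
exists 1; split=> // r r1 z; apply: (le_trans (fle z)).
by rewrite ler_peMl// ltW.
Qed.

Lemma dual_sub_continuous f g : continuous (f \- g).
Proof. by move=> x; apply: cvgB; exact: dual_continuous. Qed.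

Definition dual_sub f g : dual X := Dual (dual_sub_continuous (f := f) (g := g)).

Lemma dual_opp_continuous f : continuous (\- f).
Proof. by move=> x; apply: cvgN; exact: dual_continuous. Qed.

Definition dual_opp f : dual X := Dual (dual_opp_continuous (f := f)).

(** Apply [sublinear_lower] to the norm and the convex set of all x - c: a linear f below the
    resulting p satisfies f (c - x) <= - delta and is bounded by the norm. *)
Lemma separation C x (delta : R) : C !=set0 -> segment_closed C ->
  (forall c, C c -> delta <= `|x - c|) ->
  exists f, (forall z, `|f z| <= `|z|) /\ forall c, C c -> f c + delta <= f x.
Proof.
move=> [c0 Cc0] convC dC.
have sn : sublinear (fun z : X => `|z|).
  split=> [y z|t z t0]; first exact: ler_normD.
  by rewrite normrZ ger0_norm.
have [||_ [c Cc <-]|p [sp pn pc]] :=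
  @sublinear_lower _ _ _ [set x - c | c in C] delta sn.
- by exists (x - c0), c0.
- move=> _ _ s t [a Ca <-] [b Cb <-] s0 t0 st.
  exists (s *: a + t *: b); first exact: convC.
  by rewrite !scalerBr -[x in LHS]scale1r -st scalerDl opprD addrACA.
- exact: dC.
have [f fp] := sublinear_ge_linear sp.
have fn z : `|f z| <= `|z|.
  rewrite ler_norml (le_trans (fp _) (pn _)) andbT lerNl -linearN.
  by rewrite (le_trans (fp _))// (le_trans (pn _))// normrN.
exists (Dual (contraction_continuous fn)); split => // c Cc /=.
have := le_trans (fp _) (pc (x - c) (ex_intro2 _ _ c Cc erefl)).
by rewrite opprB linearB /=; lra.
Qed.

Lemma norming x : exists f, (forall z, `|f z| <= `|z|) /\ f x = `|x|.
Proof.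
have [||_ ->|f [fn f0]] := @separation [set 0] x `|x|.
- by exists 0.
- by move=> _ _ s t -> -> _ _ _; rewrite /= !scaler0 addr0.
- by rewrite subr0.
exists f; split=> //; apply/eqP; rewrite eq_le; apply/andP; split.
  by rewrite (le_trans (ler_norm _)).
by have := f0 0 erefl; rewrite linear0 add0r.
Qed.

Lemma dual_eq x y : (forall f, f x = f y) -> x = y.
Proof.
move=> fxy; have [f [_ fx]] := norming (x - y).
apply/eqP; rewrite -subr_eq0 -normr_eq0 -fx linearB /= fxy.
by rewrite subrr.
Qed.

Lemma dual_weak_continuous f : continuous (f : weak_space X -> R^o).
Proof.
move=> x; have : nbhs (x : weak_space X) --> (x : weak_space X) by exact: cvg_id.
move=> /(@cvg_sup _ _ (fun f : dual X =>
    Topological.on (initial_topology (f : X -> R^o)))) /(_ f) h.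
have hc := @initial_continuous X R^o f x.
move=> A fA; apply: h; exact: hc.
Qed.

(** The form in which weak compactness is used below: ultrafilter limits tested against every
    functional. *)
Lemma weakly_compact_ultra W (I : Type) (U : set_system I) (g : I -> X) :
  UltraFilter U -> weakly_compact W -> (\forall i \near U, W (g i)) ->
  exists2 y, W y & forall f, f (g i) @[i --> U] --> f y.
Proof.
move=> UU; rewrite /weakly_compact compact_ultra => cW Wg.
have [y [Wy gy]] := cW (fmap (g : I -> weak_space X) U) (fmap_ultra _ UU) Wg.
exists y => // f; apply: (@cvg_comp _ _ _ (g : I -> weak_space X) f U _ _ gy).
exact: dual_weak_continuous.
Qed.

(** Banach-Alaoglu for the dual unit ball: f_ i z stays in the compact interval [- |z|, |z|], and
    the pointwise ultrafilter limit inherits linearity and the bound. *)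
Lemma ultra_dual_cvg (I : Type) (U : set_system I) (f_ : I -> dual X) :
  UltraFilter U -> (forall i z, `|f_ i z| <= `|z|) ->
  exists f, (forall z, `|f z| <= `|z|) /\
    forall z, f_ i z @[i --> U] --> f z.
Proof.
move=> UU fle.
have /choice[f fP] : forall z, exists r : R^o,
    `|r| <= `|z| /\ f_ i z @[i --> U] --> r.
  move=> z; have := @segment_compact R (- `|z|) `|z|; rewrite compact_ultra.
  move=> /(_ (fmap (fun i => f_ i z : R) U) (fmap_ultra _ UU))[].
    by apply: (filterE (F := U)) => i; rewrite /= in_itv/= -ler_norml.
  by move=> r []; rewrite /= in_itv/= -ler_norml => rz fr; exists r.
have lf : linear f.
  move=> t x y; apply: (@cvg_unique _ (@norm_hausdorff _ _)
    (fmap (fun i => f_ i (t *: x + y)) U)).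
    exact: (fP _).2.
  have -> : (fun i => f_ i (t *: x + y)) =
            (fun i => t *: (f_ i x : R^o) + f_ i y).
    by apply/funext => i; rewrite linearP.
  by apply: cvgD; [apply: cvgZr|]; exact: (fP _).2.
pose l := HB.pack_for {linear X -> R^o} f (GRing.isLinear.Build _ _ _ _ _ lf).
have ln z : `|l z| <= `|z| := (fP z).1.
by exists (Dual (contraction_continuous ln)); split => // z; exact: (fP z).2.
Qed.

End duality.

(** * The Orlicz-Pettis theorem *)

(** Recursive choice where [phi k] may depend on all earlier values; the recursion runs on the list
    of them. *)
Lemma history_choice (P : seq nat -> nat -> Prop) :
  (forall s, exists n, P s n) ->
  exists phi : nat -> nat, forall k, P (mkseq phi k) (phi k).
Proof.
move=> /choice[next Pnext].
pose s_ k := iter k (fun s => rcons s (next s)) [::].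
exists (next \o s_) => k; suff -> : mkseq (next \o s_) k = s_ k by exact: Pnext.
by elim: k => // k IH; rewrite mkseqS IH.
Qed.

Lemma filter_seq_forall (T : eqType) (I : Type) (F : set_system I)
    (Q : T -> I -> Prop) (s : seq T) : Filter F ->
  (forall j, j \in s -> \forall i \near F, Q j i) ->
  \forall i \near F, forall j, j \in s -> Q j i.
Proof.
move=> FF; elim: s => [|j s IH] Qs; first exact: filterE.
have Qj := Qs j (mem_head _ _).
have {IH}IH := IH (fun i si => Qs i (mem_behead (s := j :: s) si)).
apply: filterS2 Qj IH => i Qj Qi k; rewrite inE => /orP[/eqP->//|].
exact: Qi.
Qed.

Section orlicz_pettis.
Context (R : realType) (X : normedModType R).
Implicit Types (f g : dual X) (x y z : X).

(* The vectors along which h tends to 0 form a closed convex set, and a closed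
   convex set is weakly closed. *)
Lemma weak_limit_null (h : nat -> dual X) (M : R) (S : nat -> X) z :
  (forall k x, `|h k x| <= M * `|x|) ->
  (forall n, h k (S n) @[k --> \oo] --> (0 : R)) ->
  (forall g, g (S n) @[n --> \oo] --> (g z : R)) ->
  h k z @[k --> \oo] --> (0 : R).
Proof.
move=> hM hS Sz; pose D := [set w : X | h k w @[k --> \oo] --> (0 : R)].
have [D_z|] := pselect (forall e, 0 < e -> exists2 d, D d & `|z - d| < e).
  apply/cvgrPdist_lt => e e0.
  have M1 : 0 < `|M| + 1 by rewrite ltr_wpDl.
  have [d Dd zd] := D_z (e / 2 / (`|M| + 1)) ltac:(by rewrite !divr_gt0).
  have := Dd; rewrite /D /= => /cvgrPdist_lt /(_ (e / 2)).
  rewrite divr_gt0// => /(_ isT); apply: filterS => k.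
  rewrite !sub0r !normrN => hd.
  rewrite -[z](subrK d) linearD; apply: (le_lt_trans (ler_normD _ _)).
  rewrite [X in _ < X](splitr e) ltr_leD// 1?ltW//.
  apply: (le_lt_trans (hM _ _)); apply: le_lt_trans (_ : (`|M| + 1) * `|z - d| < _).
    by rewrite ler_wpM2r// (le_trans (ler_norm _))// lerDl.
  by rewrite mulrC -ltr_pdivlMr.
move=> /existsNP[e /not_implyP[e0 /forall2NP De]].
have [||d Dd|g [_ gD]] := @separation _ _ D z e.
- by exists (S 0); exact: hS.
- move=> x y s t Dx Dy _ _ _; rewrite /D /=.
  have -> : (fun k => h k (s *: x + t *: y)) =
            (fun k => s *: (h k x : R^o) + t *: (h k y : R^o)).
    by apply/funext => k; rewrite linearD !linearZ.
  have -> : 0 = s *: (0 : R^o) + t *: (0 : R^o) by rewrite !scaler0 addr0.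
  by apply: cvgD; apply: cvgZr.
- by rewrite leNgt; apply/negP; case: (De d).
(* Every [S n] lies in [D], so g (S n) <= g z - e, and this survives the limit in n. *)
have : g z <= g z - e.
  apply: (cvgr_to_le (Sz g)); apply: nearW => n; rewrite lerBrDr.
  by apply: gD => /=; exact: hS.
by rewrite lerBrDr gerDl leNgt e0.
Qed.

Definition weak_cvg (S : nat -> X) z :=
  forall f, f (S n) @[n --> \oo] --> (f z : R).

Lemma dual_series f (u : nat -> X) n : f (series u n) = series (f \o u) n.
Proof. by rewrite !seriesEnat /= raddf_sum. Qed.

(* Gliding hump. If all |y n| >= eps, take norming functionals f_ n of y n, an
   ultrafilter limit f of them, and h n = f_ n - f. A subsequence phi can be
   chosen along which the matrix h (phi k) (y (phi l)) is diagonally dominant,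
   so that h (phi k) z >= eps / 2 for the weak sum z of y \o phi, although
   h (phi k) tends to 0 at each y (phi l), hence at z. *)
Lemma orlicz_pettis (y : nat -> X) (eps : R) :
  (forall phi : nat -> nat, {homo phi : m n / (m < n)%N} ->
     exists z, weak_cvg (series (y \o phi)) z) ->
  0 < eps -> exists n, `|y n| < eps.
Proof.
move=> sumy eps0; apply: contrapT => /forallNP ney.
have {}ney n : eps <= `|y n| by rewrite leNgt; apply/negP.
have y0 g : g (y n) @[n --> \oo] --> (0 : R).
  have [//|z yz] := sumy id.
  apply: cvg_series_cvg_0; apply/cvg_ex; exists (g z : R^o).
  have /= := yz g; under eq_fun do rewrite dual_series; exact.
have [U [UU ooU]] := ultraFilterLemma (F := \oo) _.
have /choice[f_ f_P] n := norming (y n).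
have [f [fle fU]] := ultra_dual_cvg UU (fun n => (f_P n).1).
pose h n := dual_sub (f_ n) f.
have hU z : h n z @[n --> U] --> (0 : R).
  by rewrite -(subrr (f z : R^o)); apply: cvgB => //; exact: cvg_cst.
(* The terms [delta k] sum to eps / 4, so a diagonal entry of at least 3/4 eps leaves eps / 2 after
   the off-diagonal terms. *)
pose delta := geometric (eps / 8) 2^-1.
have delta0 k : 0 < delta k by rewrite mulr_gt0 ?exprn_gt0 ?divr_gt0.
have delta_cvg : delta @ \oo --> (0 : R^o).
  by apply: cvg_geometric; rewrite ger0_norm; lra.
(* [s] lists the indices chosen so far: the new row is small on the old vectors, and the old rows
   are small on the new vector. *)
pose P (s : seq nat) n := [/\ forall j, j \in s -> (j < n)%N,
  forall j, j \in s -> `|h n (y j)| <= delta (size s),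
  forall j, j \in s -> `|h j (y n)| <= delta (size s) &
  3 / 4 * eps <= h n (y n)].
have [s|phi Pphi] := @history_choice P.
  suff /filter_ex[n Pn] : U (P s) by exists n.
  near=> n; split.
  - near: n; apply: filter_seq_forall => j js; apply: ooU.
    exact: nbhs_infty_gt.
  - near: n; apply: filter_seq_forall => j js.
    exact: (cvgr0_norm_le _ (hU (y j)) _ (delta0 _)).
  - near: n; apply: filter_seq_forall => j js; apply: ooU.
    exact: (cvgr0_norm_le _ (y0 (h j)) _ (delta0 _)).
  (* Since h n (y n) = |y n| - f (y n) and |y n| >= eps, this leaves 3/4 eps on the diagonal. *)
  - have : `|f (y n)| <= eps / 4.
      by near: n; apply: ooU; apply: (cvgr0_norm_le _ (y0 f)); rewrite divr_gt0.
    rewrite /h /= (f_P n).2; have := ney n; have := ler_norm (f (y n)).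
    lra.
have phi_in l k : (l < k)%N -> phi l \in mkseq phi k.
  by move=> lk; apply/mapP; exists l; rewrite // mem_iota.
have [|z phiz] := sumy phi.
  by move=> l k lk; have [+ _ _ _] := Pphi k; apply; exact: phi_in.
have hz0 : h (phi k) z @[k --> \oo] --> (0 : R).
  apply: (@weak_limit_null _ 2 (series (y \o phi))) => //.
    move=> k x; rewrite /h /= (le_trans (ler_normB _ _))//.
    by rewrite mulr_natl mulr2n lerD// (f_P _).1.
  move=> n; under eq_fun do rewrite dual_series seriesEnat.
  elim: n => [|n IH]; first by under eq_fun do rewrite /= big_geq//; exact: cvg_cst.
  under eq_fun do rewrite /= big_nat_recr//=.
  suff hn : h (phi k) (y (phi n)) @[k --> \oo] --> (0 : R).
    by have := cvgD IH hn; rewrite addr0; exact.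
  apply/cvgr0Pnorm_lt => e e0.
  have de : \forall k \near \oo, `|delta k| < e := cvgr0_norm_lt _ delta_cvg _ e0.
  near=> k; have nk : (n < k)%N by near: k; exact: nbhs_infty_gt.
  apply: (@le_lt_trans _ _ `|delta k|); last by near: k; exact: de.
  have [_ + _ _] := Pphi k; rewrite size_mkseq [leRHS]ger0_norm ?(ltW (delta0 _))//.
  by apply; exact: phi_in.
have hz k : eps / 2 <= h (phi k) z.
  apply: (cvgr_to_ge (phiz (h (phi k)))).
  apply: filterS (nbhs_infty_gt k) => n kn.
  rewrite dual_series seriesEord /= (bigD1 (Ordinal kn)) //=.
  have [_ _ _ hk] := Pphi k.
  suff : `|\sum_(i < n | i != Ordinal kn) h (phi k) (y (phi i))| <= eps / 4.
    by move=> /ler_normlP[+ _]; move: hk; rewrite /=; lra.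
  apply: (le_trans (ler_norm_sum _ _ _)).
  apply: (@le_trans _ _ (\sum_(i < n | i != Ordinal kn) delta i)).
    (* For i < k the bound comes from the choice of [phi k] and delta k <= delta i; for i > k, from
       the choice of [phi i]. *)
    apply: ler_sum => i ik; have [lik|lki|eik] := ltngtP i k.
    + have [_ + _ _] := Pphi k => /(_ _ (phi_in _ _ lik)) /le_trans; apply.
      rewrite size_mkseq /delta /= ler_pM2l ?divr_gt0//.
      by apply: ler_wiXn2l (ltnW lik); lra.
    + have [_ _ + _] := Pphi i => /(_ _ (phi_in _ _ lki)).
      by rewrite size_mkseq.
    + by case/negP: ik; apply/eqP/val_inj.
  apply: (@le_trans _ _ (\sum_(i < n) delta i)).
    rewrite [leRHS](bigD1 (Ordinal kn))//= lerDr.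
    exact: ltW.
  have -> : \sum_(i < n) delta i = eps / 4 - eps / 4 * 2^-1 ^+ n.
    elim: n {kn} => [|n IH]; first by rewrite big_ord0 expr0 mulr1 subrr.
    by rewrite big_ord_recr IH exprS /delta /=; field.
  by rewrite gerBl mulr_ge0 ?divr_ge0 ?exprn_ge0// ltW.
have : eps / 2 <= 0 by apply: (cvgr_to_ge hz0); apply: nearW.
by rewrite leNgt divr_gt0.
Unshelve. all: by end_near. Qed.

End orlicz_pettis.

(** * Weak limits, unconditional sums, and sums of two weakly compact sets *)

Section weak_limits.
Context (R : realType) (X : normedModType R).
Implicit Types (f : dual X) (x y z : X).

(** Weak lower semicontinuity of the norm, by a functional norming z. *)
Lemma weak_cvg_norm_le (u : nat -> X) z (e : R) :
  weak_cvg u z -> (\forall n \near \oo, `|u n| <= e) -> `|z| <= e.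
Proof.
move=> uz ue; have [f [fle <-]] := norming z.
apply: (cvgr_to_le (uz f)); apply: filterS ue => n.
by apply: le_trans; rewrite (le_trans (ler_norm _)).
Qed.

(** z minus a rearranged partial sum is the weak limit of [series y m] minus that sum; for large m
    this is a finite sum over distinct indices >= N, hence small in norm. *)
Lemma unconditional_sum_weak_cvg (y : nat -> X) z :
  (forall e : R, 0 < e -> exists N, forall s : seq nat, uniq s ->
     (forall k, k \in s -> (N <= k)%N) -> `|\sum_(k <- s) y k| < e) ->
  weak_cvg (series y) z -> unconditional_sum y z.
Proof.
move=> ycauchy yz s [t st ts]; apply/cvgrPdist_le => e /ycauchy[N Ny].
(* From this threshold on, the values of [s] on [0, n) cover [0, N). *)
exists (\max_(j < N) (t j).+1)%N => //= n /= Nn.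
have sumn : weak_cvg (fun m => series y m - series (y \o s) n)
                     (z - series (y \o s) n).
  move=> f; rewrite linearB; under eq_fun do rewrite linearB.
  by apply: cvgB; [exact: yz|exact: cvg_cst].
apply: (weak_cvg_norm_le sumn).
exists (\max_(j < n) (s j).+1)%N => //= m /= nm.
pose L := map s (iota 0 n).
have uL : uniq L by rewrite map_inj_uniq ?iota_uniq//; exact: can_inj st.
have Lm k : k \in L -> (k < m)%N.
  move=> /mapP[j]; rewrite mem_iota add0n /= => jn ->.
  exact: leq_trans (leq_bigmax (Ordinal jn)) nm.
have NL k : (k < N)%N -> k \in L.
  move=> kN; apply/mapP; exists (t k); rewrite ?ts// mem_iota add0n /=.
  exact: leq_trans (leq_bigmax (Ordinal kN)) Nn.
rewrite !seriesEnat /= /index_iota !subn0 (bigID (mem L)) /= -big_filter.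
have -> : \sum_(k <- iota 0 n) y (s k) = \sum_(k <- L) y k by rewrite big_map.
rewrite (perm_big L) /=; last first.
  apply: uniq_perm => //; first by rewrite filter_uniq// iota_uniq.
  move=> k; rewrite mem_filter mem_iota add0n /=.
  by have [/Lm|] := boolP (k \in L).
rewrite addrAC subrr add0r -big_filter ltW// Ny//.
  by rewrite filter_uniq// iota_uniq.
move=> k; rewrite mem_filter => /andP[kL _]; rewrite leqNgt.
by apply: contra kL => /NL.
Qed.

(** V + W is norm closed: if pairs had sums within 1/(n+1) of x, their weak ultrafilter limits a and
    b would give x = a + b. The positive distance is what [separation] requires. *)
Lemma cwk_sum_closed (V W : set X) x : cwk V -> cwk W ->
  (forall a b, V a -> W b -> x != a + b) ->
  exists2 e : R, 0 < e & forall a b, V a -> W b -> e <= `|x - (a + b)|.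
Proof.
move=> [_ _ cV] [_ _ cW] xVW; apply: contrapT => noe.
have /choice[p pP] n : exists p : X * X,
    [/\ V p.1, W p.2 & `|x - (p.1 + p.2)| < n.+1%:R^-1].
  apply: contrapT => np; apply: noe; exists n.+1%:R^-1 => // a b Va Wb.
  by rewrite leNgt; apply/negP => h; apply: np; exists (a, b).
have [U [UU ooU]] := ultraFilterLemma (F := \oo) _.
have Vp : \forall n \near U, V (p n).1 by apply: nearW => n; have [] := pP n.
have Wp : \forall n \near U, W (p n).2 by apply: nearW => n; have [] := pP n.
have [a Va pa] := weakly_compact_ultra UU cV Vp.
have [b Wb pb] := weakly_compact_ultra UU cW Wp.
have /eqP := xVW _ _ Va Wb; apply; apply: dual_eq => f.
have px : (p n).1 + (p n).2 @[n --> \oo] --> x.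
  apply/cvgrPdist_lt => e e0.
  have [N _ Ne] := near_infty_natSinv_lt (PosNum e0).
  by exists N => // n /Ne; apply: lt_trans; have [] := pP n.
have fpx : f ((p n).1 + (p n).2) @[n --> U] --> f x.
  have pxU : (p n).1 + (p n).2 @[n --> U] --> x.
    by apply: cvg_trans px => A; exact: ooU.
  exact: (cvg_comp _ _ pxU (@dual_continuous _ _ f x)).
have fpab : f ((p n).1 + (p n).2) @[n --> U] --> f (a + b).
  rewrite linearD; under eq_fun do rewrite linearD.
  by apply: cvgD; [exact: pa|exact: pb].
exact: (cvg_unique (@norm_hausdorff _ _) fpx fpab).
Qed.

End weak_limits.

(** * Weakly compact multimeasures *)

Section multimeasure.
Context d (T : measurableType d) (R : realType) (X : normedModType R).
Implicit Types (f : dual X) (x y z : X) (E F : set T) (A : nat -> set T).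

(** Abstracts one fixed level of the fuzzy integral. The support functions are recorded as reals, so
    that they can be subtracted and passed to the limit. *)
Record multimeasure (W : set T -> set X) (S : dual X -> set T -> R) := {
  multimeasure_cwk : forall E, measurable E -> cwk (W E) ;
  multimeasure_support : forall f E, measurable E ->
    support_fun f (W E) = (S f E)%:E ;
  multimeasure_set0 : forall f, S f set0 = 0 ;
  multimeasure_setU : forall f E F, measurable E -> measurable F ->
    E `&` F = set0 -> S f (E `|` F) = S f E + S f F ;
  multimeasure_bigcup : forall f A, (forall n, measurable (A n)) ->
    trivIset setT A -> series (S f \o A) @ \oo --> S f (\bigcup_n A n) }.

Context (W : set T -> set X) (S : dual X -> set T -> R).
Hypothesis WS : multimeasure W S.

Lemma cwk_segment_closed (V : set X) : cwk V -> segment_closed V.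
Proof.
move=> [_ cV _] x y s t Vx Vy s0 t0 st.
have s1 : s <= 1 by lra.
have -> : t = 1 - s by lra.
exact: set_mem (@cV x y (Itv01 s0 s1) (mem_set Vx) (mem_set Vy)).
Qed.

Lemma multimeasure_le f E x : measurable E -> W E x -> f x <= S f E.
Proof.
move=> mE Wx; rewrite -lee_fin -(multimeasure_support WS f mE).
by apply: ereal_sup_ubound; exists x.
Qed.

Lemma multimeasure_ge f E (r : R) : measurable E ->
  (forall x, W E x -> f x <= r) -> S f E <= r.
Proof.
move=> mE Wr; rewrite -lee_fin -(multimeasure_support WS f mE).
by apply: ge_ereal_sup => _ [x Wx <-]; rewrite lee_fin Wr.
Qed.

(** If x were outside W E + W F, a separating f would give S f E + S f F <= f x - e, against
    additivity and the bound on f x. *)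
Lemma multimeasure_split E F x : measurable E -> measurable F ->
  E `&` F = set0 -> (forall f, f x <= S f (E `|` F)) ->
  exists2 p : X * X, W E p.1 /\ W F p.2 & x = p.1 + p.2.
Proof.
move=> mE mF EF xS; apply: contrapT => nx.
have [[a0 Ea0] _ _] := multimeasure_cwk WS mE.
have [[b0 Fb0] _ _] := multimeasure_cwk WS mF.
have [a b Ea Fb|e e0 He] := cwk_sum_closed (x := x)
    (multimeasure_cwk WS mE) (multimeasure_cwk WS mF).
  by apply/eqP => xab; apply: nx; exists (a, b).
have [|||f [_ fx]] := @separation _ _
    [set p.1 + p.2 | p in [set p : X * X | W E p.1 /\ W F p.2]] x e.
- by exists (a0 + b0); exists (a0, b0).
- move=> _ _ s t [[a b] [/= Ea Fb] <-] [[a' b'] [/= Ea' Fb'] <-] s0 t0 st.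
  exists (s *: a + t *: a', s *: b + t *: b').
    by split; apply: cwk_segment_closed => //; exact: (multimeasure_cwk WS).
  by rewrite /= !scalerDr addrACA.
- by move=> _ [[a b] [/= Ea Fb] <-]; exact: He.
have : S f E <= f x - e - S f F.
  apply: multimeasure_ge => // a Ea; rewrite lerBrDl -lerBrDr.
  apply: multimeasure_ge => // b Fb; rewrite lerBrDr addrC.
  have := fx (a + b); rewrite linearD lerBrDr; apply.
  by exists (a, b).
have := xS f; rewrite (multimeasure_setU WS)//; lra.
Qed.

Lemma multimeasure_mem E x : measurable E ->
  W E x <-> forall f, f x <= S f E.
Proof.
move=> mE; split=> [Wx f|xS]; first exact: multimeasure_le.
(* Split E as E `|` set0: W set0 is {0} because its support function is 0. *)
have [||f|[a b] [/= Wa W0] ->] := @multimeasure_split E set0 x mE.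
- exact: measurable0.
- exact: setI0.
- by rewrite setU0.
suff -> : b = 0 by rewrite addr0.
have b0 f : f b <= 0.
  by rewrite -(multimeasure_set0 WS f); exact: multimeasure_le.
apply: dual_eq => f; rewrite linear0; apply/eqP; rewrite eq_le b0 /=.
by have := b0 (dual_opp f); rewrite /= oppr_le0.
Qed.

Lemma multimeasure_join E F x y : measurable E -> measurable F ->
  E `&` F = set0 -> W E x -> W F y -> W (E `|` F) (x + y).
Proof.
move=> mE mF EF Ex Fy; apply/multimeasure_mem => [|f]; first exact: measurableU.
by rewrite linearD (multimeasure_setU WS)// lerD// multimeasure_le.
Qed.

Definition tail A n := \bigcup_k A (n + k)%N.

Lemma tailS A n : tail A n = A n `|` tail A n.+1.
Proof.
apply/seteqP; split=> [t [[|k] _]|t [|[k _]]] At.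
- by left; rewrite addn0 in At.
- by right; exists k; rewrite // addSnnS.
- by exists 0%N; rewrite // addn0.
- by exists k.+1; rewrite // -addSnnS.
Qed.

Lemma tail_measurable A n : (forall n, measurable (A n)) -> measurable (tail A n).
Proof. by move=> mA; apply: bigcupT_measurable. Qed.

Lemma tail_disjoint A n : trivIset setT A -> A n `&` tail A n.+1 = set0.
Proof.
move=> tA; apply/seteqP; split=> // t [Ant [k _ Akt]].
have := tA n (n.+1 + k)%N I I (ex_intro _ t (conj Ant Akt)); lia.
Qed.

(** * Selections along a disjoint sequence of measurable sets *)

Section disjoint_sequence.
Variable A : nat -> set T.
Hypothesis (mA : forall n, measurable (A n)) (tA : trivIset setT A).

Lemma multimeasure_tail f n :
  series (S f \o A) n + S f (tail A n) = S f (\bigcup_n A n).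
Proof.
elim: n => [|n <-]; first by rewrite seriesEnat /= big_geq// add0r.
rewrite seriesSr -addrA; congr (_ + _); rewrite (tailS A n).
by rewrite (multimeasure_setU WS)//; [exact: tail_measurable|exact: tail_disjoint].
Qed.

Lemma multimeasure_tail_cvg f : S f (tail A n) @[n --> \oo] --> (0 : R).
Proof.
have -> : (fun n => S f (tail A n)) =
          (fun n => S f (\bigcup_n A n) - series (S f \o A) n).
  by apply/funext => n; rewrite -(multimeasure_tail f n) addrAC subrr add0r.
rewrite -(subrr (S f (\bigcup_n A n) : R^o)).
by apply: cvgB; [exact: cvg_cst|exact: (multimeasure_bigcup WS)].
Qed.

(** f (v n) lies between - S (- f) (tail A n) and S f (tail A n), and both tend to 0. *)
Lemma weak_cvg_tail (v : nat -> X) : (forall n, W (tail A n) (v n)) ->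
  weak_cvg v 0.
Proof.
move=> Wv f; rewrite linear0.
apply: (@squeeze_cvgr _ _ _ _
  (fun n => - S (dual_opp f) (tail A n)) (fun n => S f (tail A n))).
- apply: nearW => n; apply/andP; split; last first.
    by apply: multimeasure_le => //; exact: tail_measurable.
  rewrite lerNl; apply: (@multimeasure_le (dual_opp f)) => //.
  exact: tail_measurable.
- by rewrite -[0]oppr0; apply: cvgN; exact: multimeasure_tail_cvg.
- exact: multimeasure_tail_cvg.
Qed.

Lemma multimeasure_series (y : nat -> X) n t : (forall n, W (A n) (y n)) ->
  W (tail A n) t -> W (\bigcup_n A n) (series y n + t).
Proof.
move=> Wy; elim: n t => [|n IH] t Wt.
  by rewrite seriesEnat /= big_geq// add0r.
rewrite seriesSr -addrA; apply: IH; rewrite tailS.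
by apply: multimeasure_join => //; [exact: tail_measurable|exact: tail_disjoint].
Qed.

(** The gaps S f (A n) - f (y n) are nonnegative and at most S f (A n) + S (- f) (A n), whose series
    converges by countable additivity. *)
Lemma series_selection_cvg (y : nat -> X) f : (forall n, W (A n) (y n)) ->
  cvgn (series (f \o y)).
Proof.
move=> Wy; have le (g : dual X) n : g (y n) <= S g (A n) by exact: multimeasure_le.
have -> : f \o y = (S f \o A) - (fun n => S f (A n) - f (y n)).
  by apply/funext => n /=; rewrite !fctE opprB addrCA subrr addr0.
have cS g : cvgn (series (S g \o A)).
  by apply/cvg_ex; eexists; exact: (multimeasure_bigcup WS).
apply: is_cvg_seriesB => //.
apply: (@series_le_cvg _ _ ((S f \o A) + (S (dual_opp f) \o A))) => [n|n|n|].
- by rewrite subr_ge0.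
- have := le f n; have := le (dual_opp f) n; rewrite !fctE /=; lra.
- by have := le (dual_opp f) n; rewrite !fctE /= lerD2l.
- exact: is_cvg_seriesD.
Qed.

(** Adding a weakly null point of the n-th tail puts the partial sums in one weakly compact set,
    which yields an ultrafilter limit z. Convergence of each scalar series makes z the weak limit of
    the whole sequence. *)
Lemma selection_weak_cvg (y : nat -> X) : (forall n, W (A n) (y n)) ->
  exists z, weak_cvg (series y) z.
Proof.
move=> Wy.
have /choice[t Wt] n : exists t, W (tail A n) t.
  by have [] := multimeasure_cwk WS (tail_measurable n mA).
have [U [UU ooU]] := ultraFilterLemma (F := \oo) _.
have [_ _ cW] := multimeasure_cwk WS (bigcupT_measurable _ mA).
have Wg : \forall n \near U, W (\bigcup_n A n) (series y n + t n).
  by apply: nearW => n; exact: multimeasure_series.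
have [z _ zU] := weakly_compact_ultra UU cW Wg.
exists z => f; have /cvg_ex[l yl] := series_selection_cvg (f := f) Wy.
have {}yl : f (series y n) @[n --> \oo] --> l.
  by under eq_fun do rewrite dual_series.
suff <- : l = f z by [].
apply: (cvg_unique (@norm_hausdorff _ _) _ (zU f)).
apply: (@cvg_trans _ (f (series y n + t n) @[n --> \oo])).
  by move=> B; exact: ooU.
under eq_fun do rewrite linearD.
have t0 := @weak_cvg_tail t Wt f; rewrite linear0 in t0.
by have := cvgD yl t0; rewrite addr0; exact.
Qed.

Lemma multimeasure_sum (y : nat -> X) (s : seq nat) :
  (forall n, W (A n) (y n)) -> uniq s ->
  W (\bigcup_(k in [set` s]) A k) (\sum_(k <- s) y k).
Proof.
move=> Wy; elim: s => [_|k s IH /= /andP[ks us]].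
  rewrite set_nil bigcup_set0 big_nil.
  apply/multimeasure_mem => [|f]; first exact: measurable0.
  by rewrite linear0 (multimeasure_set0 WS).
have -> : [set` k :: s] = k |` [set` s].
  apply/seteqP; split=> j /=; rewrite inE.
    by move=> /orP[/eqP ->|]; [left|right].
  by move=> [->|->]; rewrite ?eqxx ?orbT.
rewrite bigcup_setU1 big_cons; apply: multimeasure_join => //.
- exact: bigcup_measurable.
- apply/seteqP; split=> // t [Akt [j /= js Ajt]].
  by move: ks; rewrite (tA I I (ex_intro _ t (conj Akt Ajt))) js.
- exact: IH.
Qed.

End disjoint_sequence.

(* Otherwise there are disjoint blocks of terms with sums of norm >= e; these
   sums are selections of W on disjoint sets, contradicting orlicz_pettis. *)
Lemma selection_unconditional_cauchy A (y : nat -> X) (e : R) :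
  (forall n, measurable (A n)) -> trivIset setT A ->
  (forall n, W (A n) (y n)) -> 0 < e ->
  exists N, forall s : seq nat, uniq s ->
    (forall k, k \in s -> (N <= k)%N) -> `|\sum_(k <- s) y k| < e.
Proof.
move=> mA tA Wy e0; apply: contrapT => /forallNP nN.
have /choice[F FP] N : exists s : seq nat, [/\ uniq s,
    forall k, k \in s -> (N <= k)%N & e <= `|\sum_(k <- s) y k|].
  have /existsNP[s /not_implyP[us /not_implyP[sN /negP]]] := nN N.
  by rewrite -leNgt; exists s.
(* The next threshold exceeds every index of the current block, so distinct blocks are disjoint. *)
pose N_ l := iter l (fun N => N.+1 + \max_(k <- F N) k)%N 0%N.
pose B l := \bigcup_(k in [set` F (N_ l)]) A k.
have FN l k : k \in F (N_ l) -> (N_ l <= k < N_ l.+1)%N.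
  move=> kF; have [_ /(_ k kF) -> _] := FP (N_ l).
  by rewrite /N_ /= addSn ltnS (leq_trans _ (leq_addl _ _))// leq_bigmax_seq.
have N_le l m : (l <= m)%N -> (N_ l <= N_ m)%N.
  elim: m => [|m IH]; first by rewrite leqn0 => /eqP->.
  rewrite leq_eqVlt => /orP[/eqP->//|/IH /leq_trans]; apply.
  by rewrite /N_ /= addSn leqW// leq_addr.
have disj l m t : (l < m)%N -> B l t -> B m t -> False.
  move=> lm [j /= jF Ajt] [k /= kF Akt].
  have jk := tA j k I I (ex_intro _ t (conj Ajt Akt)); subst k.
  have /andP[_ jl] := FN _ _ jF; have /andP[mj _] := FN _ _ kF.
  by have := leq_trans jl (leq_trans (N_le _ _ lm) mj); rewrite ltnn.
have tB : trivIset setT B.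
  move=> l m _ _ [t [Blt Bmt]]; have [lm|ml|//] := ltngtP l m.
    by have := disj _ _ _ lm Blt Bmt.
  by have := disj _ _ _ ml Bmt Blt.
have WB l : W (B l) (\sum_(k <- F (N_ l)) y k).
  by apply: multimeasure_sum => //; have [] := FP (N_ l).
have [phi phi_homo|l] := @orlicz_pettis _ _
    (fun l => \sum_(k <- F (N_ l)) y k) e _ e0; last first.
  by have [_ _] := FP (N_ l); rewrite leNgt => /negP.
(* Any subsequence of blocks is again a selection along disjoint sets, so its series converges
   weakly. *)
apply: (@selection_weak_cvg (B \o phi)) => [n||n].
- exact: bigcup_measurable.
- move=> l m _ _ /(tB _ _ I I) eq_phi.
  by have [/phi_homo|/phi_homo|//] := ltngtP l m; rewrite eq_phi ltnn.
- exact: WB.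
Qed.

Lemma selection_decomposition A x :
  (forall n, measurable (A n)) -> trivIset setT A -> W (\bigcup_n A n) x ->
  exists2 y : nat -> X, forall n, W (A n) (y n) & unconditional_sum y x.
Proof.
move=> mA tA Wx.
(* One peeling step as a total function; (0, 0) is a dummy value for points outside the tail. *)
have /choice[g gP] (nv : nat * X) : exists p : X * X, W (tail A nv.1) nv.2 ->
    [/\ W (A nv.1) p.1, W (tail A nv.1.+1) p.2 & nv.2 = p.1 + p.2].
  have [Wnv|] := pselect (W (tail A nv.1) nv.2); last by exists (0, 0).
  have [|||f|p [W1 W2] nvE] := @multimeasure_split (A nv.1) (tail A nv.1.+1) nv.2.
  - exact: mA.
  - exact: tail_measurable.
  - exact: tail_disjoint.
  - by rewrite -tailS; apply: multimeasure_le => //; exact: tail_measurable.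
  - by exists p.
(* [v n] is what remains of x after n terms; [y n] below is the term peeled off next. *)
pose v := fix v n := if n is m.+1 then (g (m, v m)).2 else x.
have Wv n : W (tail A n) (v n).
  by elim: n => [|n IH] //=; have [] := gP (n, v n) IH.
pose y n := (g (n, v n)).1.
have Wy n : W (A n) (y n) by have [] := gP (n, v n) (Wv n).
have xE n : series y n = x - v n.
  elim: n => [|n IH]; first by rewrite seriesEnat /= big_geq// subrr.
  have [_ _ /=] := gP (n, v n) (Wv n); rewrite seriesSr IH /y /=.
  by move: (g (n, v n)) => p ->; rewrite opprD addrA addrAC subrK.
exists y => //; apply: unconditional_sum_weak_cvg => [e|f].
  exact: selection_unconditional_cauchy.
under eq_fun do rewrite xE linearB.
have := @weak_cvg_tail A mA tA v Wv f; rewrite linear0 => v0.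
by have := cvgB (cvg_cst (f x : R^o)) v0; rewrite subr0; exact.
Qed.

(** Pass to the limit in the inequality between the partial sums of f (y k) and of S f (A k), then
    conclude by [multimeasure_mem]. *)
Lemma unconditional_sum_mem A (y : nat -> X) x :
  (forall n, measurable (A n)) -> trivIset setT A ->
  (forall n, W (A n) (y n)) -> unconditional_sum y x -> W (\bigcup_n A n) x.
Proof.
move=> mA tA Wy yx; apply/multimeasure_mem => [|f].
  exact: bigcupT_measurable.
have {}yx : series y @ \oo --> x by apply: (yx id); exists id.
have fyx : f (series y n) @[n --> \oo] --> f x.
  exact: (cvg_comp _ _ yx (@dual_continuous _ _ f x)).
have := ler_cvg_to (R := R) fyx (multimeasure_bigcup WS (f := f) mA tA); apply.
apply: nearW => n; rewrite dual_series !seriesEnat /=.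
by apply: ler_sum => k _; exact: multimeasure_le.
Qed.

End multimeasure.

(** * The fuzzy Pettis integral *)

Section fuzzy_pettis.
Context d (T : measurableType d) (R : realType) (mu : {measure set T -> \bar R}).
Context (X : normedModType R) (G : T -> fuzzyNumber X) (M : set T -> fuzzyNumber X).
Hypotheses (G_int : fuzzy_pettis_integrable mu G)
  (M_int : is_fuzzy_pettis_integral mu G M).

(** Scalar integrability makes each indefinite integral of a support function a finite charge, which
    supplies both kinds of additivity. *)
Lemma fuzzy_pettis_multimeasure (r : R) : 0 < r <= 1 ->
  multimeasure (fun E => level (M E) r)
    (fun f E => fine (\int[mu]_(w in E) support_fun f (level (G w) r))).
Proof.
move=> r01; have [[_ sG] _] := G_int.1 r r01.
pose nu f := induced_charge (sG f).
have nuE f E : measurable E -> nu f E = (fine (nu f E))%:E.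
  by move=> mE; rewrite fineK//; exact: fin_num_measure.
split=> [E mE|f E mE|f|f E F mE mF EF|f A mA tA].
- exact: fuzzy_fun_cwk.
- by rewrite (M_int mE)//; exact: (nuE f).
- by rewrite integral_set0.
- rewrite -fineD; [|exact: (fin_num_measure (nu f))..].
  by congr fine; exact: (chargeU (nu f)).
- have nu_sigma : semi_sigma_additive (nu f) by exact: charge_semi_sigma_additive.
  have mUA : measurable (\bigcup_n A n) := bigcupT_measurable _ mA.
  have := nu_sigma A mA tA mUA; rewrite (nuE f _ mUA).
  move/fine_cvg; apply: cvg_trans; apply: near_eq_cvg; apply: nearW => n /=.
  rewrite seriesEnat /= sum_fine// => i _.
  exact: (fin_num_measure (nu f)).
Qed.

Lemma fuzzy_pettis_set0 : M set0 = fuzzy_null X.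
Proof.
(* Every level of [M set0] is {0}, because its support function vanishes. *)
have lev r x : 0 < r <= 1 -> (r <= M set0 x) = (x == 0).
  move=> r01; have WS := fuzzy_pettis_multimeasure r01.
  apply/idP/eqP => [rx|->].
    apply: dual_eq => f; rewrite linear0.
    have le0 (g : dual X) : g x <= 0.
      by rewrite -(multimeasure_set0 WS g); exact: (multimeasure_le WS).
    by apply/eqP; rewrite eq_le le0 /= -oppr_le0 (le0 (dual_opp f)).
  apply/(multimeasure_mem WS _ measurable0) => f.
  by rewrite linear0 (multimeasure_set0 WS).
have M0 x : M set0 x = fuzzy_null_fun x.
  rewrite /fuzzy_null_fun; have /andP[Mx0 Mx1] := fuzzy_fun01 (M set0) x.
  have [x0|x0] := eqVneq x 0.
    by apply/eqP; rewrite eq_le Mx1 (lev 1 x) ?x0 ?eqxx// ltr01 lexx.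
  apply/eqP; rewrite eq_le Mx0 andbT leNgt; apply/negP => Mx.
  by have := lev (M set0 x) x; rewrite Mx Mx1 lexx (negbTE x0) => /(_ isT).
rewrite /fuzzy_null; case: (M set0) M0 => u u01 ucwk /= /funext uE.
by subst u; congr FuzzyNumber; exact: Prop_irrelevance.
Qed.

(** Ensures that the set under [sup] in [fuzzy_sum] is never empty. *)
Lemma unconditional_sum_single (x : X) :
  unconditional_sum (fun n => if n is 0%N then x else 0) x.
Proof.
move=> s [t st ts]; apply/cvgrPdist_le => e e0.
exists (t 0%N).+1 => // n /= tn; rewrite seriesEord /=.
rewrite (bigD1 (Ordinal tn))//= ts big1 ?addr0 ?subrr ?normr0 ?ltW// => i it.
case sE: (s i) => [|//]; case/negP: it; apply/eqP/val_inj => /=.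
by rewrite -sE st.
Qed.

Lemma fuzzy_pettis_bigcup (A : nat -> set T) :
  (forall n, measurable (A n)) -> trivIset setT A ->
  M (\bigcup_n A n) = fuzzy_sum (fun n => M (A n)) :> (X -> R).
Proof.
move=> mA tA; apply/funext => x; rewrite /fuzzy_sum; set V := (X in sup X).
pose I (y : nat -> X) := range (fun n => M (A n) (y n)).
have M01 E z : 0 <= M E z <= 1 := fuzzy_fun01 (M E) z.
have Ilb y : has_lbound (I y).
  by exists 0 => _ [n _ <-]; have /andP[] := M01 (A n) (y n).
have I0 y : 0 <= inf (I y).
  apply: lb_le_inf; first by exists (M (A 0%N) (y 0%N)), 0%N.
  by move=> _ [n _ <-]; have /andP[] := M01 (A n) (y n).
have I_le y n : inf (I y) <= M (A n) (y n) by apply: ge_inf => //; exists n.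
have Vub : has_ubound V.
  exists 1 => _ [y _ <-]; apply: le_trans (I_le y 0%N) _.
  by have /andP[] := M01 (A 0%N) (y 0%N).
apply/eqP; rewrite eq_le; apply/andP; split.
  have /andP[+ Mx1] := M01 (\bigcup_n A n) x.
  (* Only levels r > 0 are available, so the value 0 is treated apart: [V] contains a nonnegative
     number. *)
  rewrite [0 <= _]le_eqVlt => /orP[/eqP<-|Mx0].
    apply: le_trans (I0 (fun n => if n is 0%N then x else 0)) _.
    by apply: ub_le_sup => //; eexists; [exact: unconditional_sum_single|].
  (* At the level r = M (\bigcup_n A n) x, decomposing x gives terms with M (A n) (y n) >= r for all
     n. *)
  have Mx01 : 0 < M (\bigcup_n A n) x <= 1 by rewrite Mx0.
  have WS := fuzzy_pettis_multimeasure Mx01.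
  have [y yM yx] := selection_decomposition WS mA tA (lexx (M (\bigcup_n A n) x)).
  apply: (@le_trans _ _ (inf (I y))); last by apply: ub_le_sup => //; exists y.
  apply: lb_le_inf; first by exists (M (A 0%N) (y 0%N)), 0%N.
  by move=> _ [n _ <-]; exact: yM.
apply: ge_sup.
  by eexists; eexists; first exact: unconditional_sum_single.
move=> _ [y yx <-]; rewrite -/(I y).
have := I0 y; rewrite [0 <= _]le_eqVlt => /orP[/eqP<-|Iy0].
  by have /andP[] := M01 (\bigcup_n A n) x.
(* At the level r = inf (I y), every [y n] lies in the level of [M (A n)], so x lies in that of the
   union. *)
have Iy01 : 0 < inf (I y) <= 1.
  rewrite Iy0 (le_trans (I_le y 0%N))//.
  by have /andP[] := M01 (A 0%N) (y 0%N).
exact: (unconditional_sum_mem (fuzzy_pettis_multimeasure Iy01) mA tA (I_le y) yx).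
Qed.

End fuzzy_pettis.

Theorem theorem3p5 (R : realType) (d : measure_display) (T : measurableType d)
    (mu : {measure set T -> \bar R}) (X : completeNormedModType R)
    (G : T -> fuzzyNumber X) (G_int : fuzzy_pettis_integrable mu G)
    (M : set T -> fuzzyNumber X) (M_int : is_fuzzy_pettis_integral mu G M) :
  fuzzy_number_measure M.
Proof.
by split; [exact: fuzzy_pettis_set0 G_int M_int|exact: fuzzy_pettis_bigcup G_int M_int].
Qed.
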